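(* Let $a=1+a_2\mathbf j+a_3\mathbf k$ with $a_2,a_3\in\mathbb R$, $a_2^2+a_3^2=1$, let $b=b_1\mathbf i+b_2\mathbf j+b_3\mathbf k\ne0$ and $c=c_0+c_1\mathbf i+c_2\mathbf j+c_3\mathbf k\in\mathbb H_s$, and assume $P_{ab}\neq0$. Put $$\delta=a_2b_3-a_3b_2+b_1,\quad t_1=c_2-c_0a_2-a_3c_1,\quad t_2=c_3-c_0a_3+a_2c_1,\quad x_0=\frac{-I_b}{4P_{ab}},$$ $$k_1=2b_2\delta-a_3I_b,\quad k_2=-2b_3\delta-a_2I_b,\quad m=2b_1\delta-I_b,\quad \Delta_1=\frac{-P_{ab}t_1-\delta t_2}{m},\quad\Delta_2=\frac{\delta t_1-P_{ab}t_2}{m},$$ $$R=\frac{2k_1\Delta_1-2k_2\Delta_2+b_2k_1-b_3k_2+2(a_2k_1-a_3k_2)x_0-mb_1}{m},$$ $$L=b_2\Delta_1+b_3\Delta_2+\Delta_1^2+\Delta_2^2+c_0+\frac{2(a_2k_2+a_3k_1+m)}{m}x_0^2+\frac{2k_2\Delta_1+2k_1\Delta_2+b_2k_2+b_3k_1+2a_2\Delta_1m+2a_3\Delta_2m}{m}x_0,$$ $$F=\frac{2a_3k_2-2a_2k_1}{m}x_0^2+\Big(\frac{b_3k_2-b_2k_1}{m}+2a_3\Delta_1-2a_2\Delta_2+b_1\Big)x_0+b_3\Delta_1-b_2\Delta_2+c_1.$$ The equation $ax^2+bx+c=0$ has a solution $x\in\mathbb H_s$ with $2\Re(x)a+b\in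 Z(\mathbb H_s)$ if and only if Condition B holds, namely: $F=0$, and if $R=0$ then $L=0$. If Condition B holds, then: (1) If $R\ne0$, the equation has the solution $x=x_0-\frac LR\mathbf i+x_2\mathbf j+x_3\mathbf k$, where $x_2=-\frac{k_1L}{mR}+\frac{k_2}{m}x_0+\Delta_1$ and $x_3=\frac{k_2L}{mR}+\frac{k_1}{m}x_0+\Delta_2$. (2) If $R=0$, the equation has the solutions $$x=x_0+x_1\mathbf i+\Big(\frac{k_1}{m}x_1+\frac{k_2}{m}x_0+\Delta_1\Big)\mathbf j+\Big(-\frac{k_2}{m}x_1+\frac{k_1}{m}x_0+\Delta_2\Big)\mathbf k,\quad\forall x_1\in\mathbb R.$$
   Context: $\mathbb H_s$ is the split quaternion algebra: the 4-dimensional associative real algebra with basis $1,\mathbf i,\mathbf j,\mathbf k$ and $\mathbf i^2=-1$, $\mathbf j^2=\mathbf k^2=1$, $\mathbf i\mathbf j=\mathbf k=-\mathbf j\mathbf i$, $\mathbf j\mathbf k=-\mathbf i=-\mathbf k\mathbf j$, $\mathbf k\mathbf i=\mathbf j=-\mathbf i\mathbf k$. For $x=x_0+x_1\mathbf i+x_2\mathbf j+x_3\mathbf k$ and $y=y_0+y_1\mathbf i+y_2\mathbf j+y_3\mathbf k$ with real coefficients: $\Re(x)=x_0$, $P_{xy}=\langle x,y\rangle=x_0y_0+x_1y_1-x_2y_2-x_3y_3$, $I_x=\langle x,x\rangle$, $Z(\mathbb H_s)=\{x\in\mathbb H_s:I_x=0\}$. Thus $P_{ab}=-a_2b_2-a_3b_3$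 for the $a,b$ here. *)

(* Defs.v *)
From HB Require Import structures.
From mathcomp Require Import all_boot all_order all_algebra.
From mathcomp Require Import reals ring.

Set Implicit Arguments.
Unset Strict Implicit.
Unset Printing Implicit Defensive.

Import Order.TTheory GRing.Theory Num.Theory.
Local Open Scope ring_scope.

(* [SplitQuat x0 x1 x2 x3] is x0 + x1 i + x2 j + x3 k (see [splitquatE]). *)
Record splitquat (K : realType) :=
  SplitQuat { sq0 : K; sq1 : K; sq2 : K; sq3 : K }.

Section SplitQuaternionAlgebra.
Variable K : realType.
Local Notation H := (splitquat K).
Implicit Types x y z : H.

Definition sq_to_tuple x : K * K * K * K := (sq0 x, sq1 x, sq2 x, sq3 x).
Definition sq_of_tuple (t : K * K * K * K) : H :=
  let: (x0, x1, x2, x3) := t in SplitQuat x0 x1 x2 x3.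

Lemma sq_to_tupleK : cancel sq_to_tuple sq_of_tuple.
Proof. by case. Qed.

HB.instance Definition _ := Choice.copy H (can_type sq_to_tupleK).

Definition sq_zero : H := SplitQuat 0 0 0 0.
Definition sq_opp x : H := SplitQuat (- sq0 x) (- sq1 x) (- sq2 x) (- sq3 x).
Definition sq_add x y : H :=
  SplitQuat (sq0 x + sq0 y) (sq1 x + sq1 y) (sq2 x + sq2 y) (sq3 x + sq3 y).

Lemma sq_addA : associative sq_add.
Proof. by move=> x y z; rewrite /sq_add /= !addrA. Qed.

Lemma sq_addC : commutative sq_add.
Proof. by move=> x y; congr SplitQuat; rewrite addrC. Qed.

Lemma sq_add0 : left_id sq_zero sq_add.
Proof. by case=> *; rewrite /sq_add /= !add0r. Qed.

Lemma sq_addN : left_inverse sq_zero sq_opp sq_add.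
Proof. by move=> x; rewrite /sq_add /= !addNr. Qed.

HB.instance Definition _ :=
  GRing.isZmodule.Build H sq_addA sq_addC sq_add0 sq_addN.

Definition sq_one : H := SplitQuat 1 0 0 0.

(* Bilinear extension of the multiplication table of 1, i, j, k
   ([sqii], ..., [sqik] below). *)
Definition sq_mul x y : H :=
  let: SplitQuat x0 x1 x2 x3 := x in
  let: SplitQuat y0 y1 y2 y3 := y in
  SplitQuat (x0 * y0 - x1 * y1 + x2 * y2 + x3 * y3)
            (x0 * y1 + x1 * y0 - x2 * y3 + x3 * y2)
            (x0 * y2 + x2 * y0 + x3 * y1 - x1 * y3)
            (x0 * y3 + x3 * y0 + x1 * y2 - x2 * y1).

Lemma sq_mulA : associative sq_mul.
Proof. by case=> ? ? ? ? [? ? ? ?] [? ? ? ?]; congr SplitQuat; ring. Qed.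

Lemma sq_mul1l : left_id sq_one sq_mul.
Proof. by case=> ? ? ? ?; congr SplitQuat; ring. Qed.

Lemma sq_mul1r : right_id sq_one sq_mul.
Proof. by case=> ? ? ? ?; congr SplitQuat; ring. Qed.

Lemma sq_mulDl : left_distributive sq_mul sq_add.
Proof. by case=> ? ? ? ? [? ? ? ?] [? ? ? ?]; congr SplitQuat => /=; ring. Qed.

Lemma sq_mulDr : right_distributive sq_mul sq_add.
Proof. by case=> ? ? ? ? [? ? ? ?] [? ? ? ?]; congr SplitQuat => /=; ring. Qed.

Lemma sq_one_neq0 : sq_one != 0.
Proof. by apply/eqP=> -[] /eqP; rewrite oner_eq0. Qed.

HB.instance Definition _ := GRing.Zmodule_isNzRing.Build H
  sq_mulA sq_mul1l sq_mul1r sq_mulDl sq_mulDr sq_one_neq0.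

Definition sq_scale (r : K) x : H :=
  SplitQuat (r * sq0 x) (r * sq1 x) (r * sq2 x) (r * sq3 x).

Lemma sq_scaleA r s x : sq_scale r (sq_scale s x) = sq_scale (r * s) x.
Proof. by rewrite /sq_scale /= !mulrA. Qed.

Lemma sq_scale1 : left_id 1 sq_scale.
Proof. by case=> *; rewrite /sq_scale /= !mul1r. Qed.

Lemma sq_scaleDr : right_distributive sq_scale +%R.
Proof. by move=> r x y; congr SplitQuat; rewrite /= mulrDr. Qed.

Lemma sq_scaleDl x : {morph sq_scale^~ x : r s / r + s}.
Proof. by move=> r s; congr SplitQuat; rewrite /= mulrDl. Qed.

HB.instance Definition _ := GRing.Zmodule_isLmodule.Build K H
  sq_scaleA sq_scale1 sq_scaleDr sq_scaleDl.

Lemma sq_scaleAl (r : K) x y : r *: (x * y) = (r *: x) * y.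
Proof. by case: x y => ? ? ? ? [? ? ? ?]; congr SplitQuat => /=; ring. Qed.

HB.instance Definition _ := GRing.Lmodule_isLalgebra.Build K H sq_scaleAl.

Lemma sq_scaleAr (r : K) x y : r *: (x * y) = x * (r *: y).
Proof. by case: x y => ? ? ? ? [? ? ? ?]; congr SplitQuat => /=; ring. Qed.

HB.instance Definition _ := GRing.Lalgebra_isAlgebra.Build K H sq_scaleAr.

Definition sqi : H := SplitQuat 0 1 0 0.
Definition sqj : H := SplitQuat 0 0 1 0.
Definition sqk : H := SplitQuat 0 0 0 1.

Lemma splitquatE (x0 x1 x2 x3 : K) :
  SplitQuat x0 x1 x2 x3 = x0%:A + x1 *: sqi + x2 *: sqj + x3 *: sqk.
Proof. by congr SplitQuat => /=; ring. Qed.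

Lemma sqii : sqi * sqi = -1. Proof. by congr SplitQuat => /=; ring. Qed.
Lemma sqjj : sqj * sqj = 1.  Proof. by congr SplitQuat => /=; ring. Qed.
Lemma sqkk : sqk * sqk = 1.  Proof. by congr SplitQuat => /=; ring. Qed.
Lemma sqij : sqi * sqj = sqk. Proof. by congr SplitQuat => /=; ring. Qed.
Lemma sqji : sqj * sqi = - sqk. Proof. by congr SplitQuat => /=; ring. Qed.
Lemma sqjk : sqj * sqk = - sqi. Proof. by congr SplitQuat => /=; ring. Qed.
Lemma sqkj : sqk * sqj = sqi. Proof. by congr SplitQuat => /=; ring. Qed.
Lemma sqki : sqk * sqi = sqj. Proof. by congr SplitQuat => /=; ring. Qed.
Lemma sqik : sqi * sqk = - sqj. Proof. by congr SplitQuat => /=; ring. Qed.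

Definition sqRe x : K := sq0 x.

Definition sqform x y : K :=
  sq0 x * sq0 y + sq1 x * sq1 y - sq2 x * sq2 y - sq3 x * sq3 y.

Definition sqnull : {pred H} := [pred x | sqform x x == 0].

End SplitQuaternionAlgebra.

Arguments sqi {K}.
Arguments sqj {K}.
Arguments sqk {K}.
Arguments sqnull {K}.

(* Main.v *)
Require Import Defs.
From HB Require Import structures.
From mathcomp Require Import all_boot all_order all_algebra.
From mathcomp Require Import reals.
From mathcomp Require Import ring.

Set Implicit Arguments.
Unset Strict Implicit.
Unset Printing Implicit Defensive.

Import Order.TTheory GRing.Theory Num.Theory.
Local Open Scope ring_scope.

(** Write [x = x0 + x1 i + x2 j + x3 k] and [N x = sqform x x].

    Because [a] is null, [N (2 x0 a + b) = 4 x0 Pab + Ib]; the class condition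
    therefore amounts to fixing [x0 = - Ib / (4 Pab)].

    Multiplying the equation on the left by the conjugate of [a], which kills
    [a], removes the quadratic term.  What remains are two real linear
    equations, which as a system in [(x2, x3)] have the matrix
    [[Pab, -delta], [delta, Pab]] of multiplication by a complex number
    ([quadratic_coordsP]).  Its determinant is [Pab^2 + delta^2 = m]
    ([det_sum_squares]), nonzero since [Pab] is.  Solving ([rotation_systemP])
    gives [x2 = p x1 + q x0 + D1] and [x3 = - q x1 + p x0 + D2] with
    [p = k1 / m], [q = k2 / m], and [p^2 + q^2 = 1] ([slopes_sum_squares]).

    Two equations are left, the components of the original one along [1] and
    [i].  Substituting [x2] and [x3] in the first, the [x1^2] terms cancel
    because [p^2 + q^2 = 1], so that it becomes the affine equation
    [R x1 + L = 0] ([real_component_affine]).  In the second, the coefficient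
    of [x1] is a multiple of [4 x0 Pab + Ib], which is zero by the class
    condition ([slope_cancel]), so that it becomes [F = 0]
    ([i_component_affine]).  The theorem is then the discussion of
    [F = 0] and [R x1 + L = 0] in the single unknown [x1]. *)

(** * Coordinates in the split quaternions *)

Lemma splitquat_eqP (K : realType) (x0 x1 x2 x3 y0 y1 y2 y3 : K) :
  SplitQuat x0 x1 x2 x3 = SplitQuat y0 y1 y2 y3 <->
  [/\ x0 = y0, x1 = y1, x2 = y2 & x3 = y3].
Proof. by split=> [[]|[-> -> -> ->]]. Qed.

Lemma sqform_lincomb (K : realType) (r : K) (x y : splitquat K) :
  sqform (r *: x + y) (r *: x + y) =
  r ^+ 2 * sqform x x + 2 * r * sqform x y + sqform y y.
Proof.
by case: x y => x0 x1 x2 x3 [y0 y1 y2 y3]; rewrite /sqform /=; ring.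
Qed.

(** The last two equations are the components along [j] and [k] after
    elimination of [x ^+ 2] by means of the components along [1] and [i];
    this is the content of multiplying by the conjugate of the null
    quaternion [1 + a2 j + a3 k]. *)
Lemma quadratic_coordsP (K : realType)
    (a2 a3 b1 b2 b3 c0 c1 c2 c3 x0 x1 x2 x3 : K) :
  let P := - (a2 * b2) - a3 * b3 in
  let d := a2 * b3 - a3 * b2 + b1 in
  let x := SplitQuat x0 x1 x2 x3 in
  a2 ^+ 2 + a3 ^+ 2 = 1 ->
  SplitQuat 1 0 a2 a3 * x ^+ 2 + SplitQuat 0 b1 b2 b3 * x
    + SplitQuat c0 c1 c2 c3 = 0 <->
  [/\ x0 ^+ 2 - x1 ^+ 2 + x2 ^+ 2 + x3 ^+ 2 + 2 * x0 * (a2 * x2 + a3 * x3)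
        - b1 * x1 + b2 * x2 + b3 * x3 + c0 = 0,
      2 * x0 * (x1 + a3 * x2 - a2 * x3) + b1 * x0 + b3 * x2 - b2 * x3 + c1 = 0,
      P * x2 - d * x3 =
        - (c2 - c0 * a2 - a3 * c1 + (b3 + a2 * b1) * x1
           + (b2 - a3 * b1) * x0) &
      d * x2 + P * x3 =
        - (c3 - c0 * a3 + a2 * c1 - (b2 - a3 * b1) * x1
           + (b3 + a2 * b1) * x0)].
Proof.
move=> P d x a_null.
set e0 := (X in [/\ X = 0, _, _ & _]).
set e1 := (X in [/\ _, X = 0, _ & _]).
set f2 := (X in [/\ _, _, X = _ & _]); set g2 := (X in [/\ _, _, f2 = X & _]).
set f3 := (X in [/\ _, _, _ & X = _]); set g3 := (X in [/\ _, _, _ & f3 = X]).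
have -> : SplitQuat 1 0 a2 a3 * x ^+ 2 + SplitQuat 0 b1 b2 b3 * x
            + SplitQuat c0 c1 c2 c3 =
          SplitQuat e0 e1
            (f2 - g2 + a2 * e0 + a3 * e1
              - (a2 ^+ 2 + a3 ^+ 2 - 1) * (2 * x0 * x2))
            (f3 - g3 + a3 * e0 - a2 * e1
              - (a2 ^+ 2 + a3 ^+ 2 - 1) * (2 * x0 * x3)).
  rewrite expr2 /x /e0 /e1 /f2 /g2 /f3 /g3 /P /d.
  by congr SplitQuat => /=; ring.
rewrite a_null subrr !mul0r !subr0.
split=> [/splitquat_eqP[-> ->]|[-> ->]].
  rewrite !mulr0 !(subr0, addr0) => E2 E3.
  by split=> //; apply/eqP; rewrite -subr_eq0; apply/eqP.
move=> -> ->; apply/splitquat_eqP.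
by rewrite !subrr !mulr0 !(subr0, addr0).
Qed.

(** * The linear system for the last two coordinates *)

Lemma rotation_systemP (K : fieldType) (P d s t u v : K) :
  P ^+ 2 + d ^+ 2 != 0 ->
  (P * u - d * v = - s /\ d * u + P * v = - t) <->
  (u = (- P * s - d * t) / (P ^+ 2 + d ^+ 2) /\
   v = (d * s - P * t) / (P ^+ 2 + d ^+ 2)).
Proof.
move=> nz; split=> [[Es Et]|[-> ->]]; last by split; field.
rewrite -[s]opprK -[t]opprK -Es -Et.
by split; field.
Qed.

(** Over the reals, with a complex [i], both sides are
    [|(a2 - a3 i) (b2 + b3 i) + b1 i|^2], where the factor [a2 - a3 i] has
    modulus one. *)
Lemma det_sum_squares (K : comNzRingType) (a2 a3 b1 b2 b3 : K) :
  let P := - (a2 * b2) - a3 * b3 in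
  let d := a2 * b3 - a3 * b2 + b1 in
  let I := b1 ^+ 2 - b2 ^+ 2 - b3 ^+ 2 in
  a2 ^+ 2 + a3 ^+ 2 = 1 -> 2 * b1 * d - I = P ^+ 2 + d ^+ 2.
Proof.
move=> P d I a_null; apply/esym/eqP; rewrite -subr_eq0; apply/eqP.
have -> : P ^+ 2 + d ^+ 2 - (2 * b1 * d - I) =
          (a2 ^+ 2 + a3 ^+ 2 - 1) * (b2 ^+ 2 + b3 ^+ 2).
  by rewrite /P /d /I; ring.
by rewrite a_null subrr mul0r.
Qed.

(** The coefficients of [x1] and [x0] produced by [rotation_systemP] come with
    these right-hand sides as numerators. *)
Lemma slope_numerators (K : comNzRingType) (a2 a3 b1 b2 b3 : K) :
  let P := - (a2 * b2) - a3 * b3 in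
  let d := a2 * b3 - a3 * b2 + b1 in
  let I := b1 ^+ 2 - b2 ^+ 2 - b3 ^+ 2 in
  a2 ^+ 2 + a3 ^+ 2 = 1 ->
  2 * b2 * d - a3 * I = - P * (b3 + a2 * b1) + d * (b2 - a3 * b1) /\
  - 2 * b3 * d - a2 * I = - P * (b2 - a3 * b1) - d * (b3 + a2 * b1).
Proof.
move=> P d I a_null; split; apply/eqP; rewrite -subr_eq0; apply/eqP.
  have -> : 2 * b2 * d - a3 * I
              - (- P * (b3 + a2 * b1) + d * (b2 - a3 * b1)) =
            (a2 ^+ 2 + a3 ^+ 2 - 1) * - (b1 * b2).
    by rewrite /P /d /I; ring.
  by rewrite a_null subrr mul0r.
have -> : - 2 * b3 * d - a2 * I
            - (- P * (b2 - a3 * b1) - d * (b3 + a2 * b1)) =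
          (a2 ^+ 2 + a3 ^+ 2 - 1) * (b1 * b3).
  by rewrite /P /d /I; ring.
by rewrite a_null subrr mul0r.
Qed.

(** By [slope_numerators], [k1 + i k2 = - (P + i d) w] for
    [w = (b3 + i b2) + b1 (a2 - i a3)], and both [|P + i d|^2] and [|w|^2]
    are equal to [m = 2 b1 d - I]. *)
Lemma slopes_sum_squares (K : comNzRingType) (a2 a3 b1 b2 b3 : K) :
  let d := a2 * b3 - a3 * b2 + b1 in
  let I := b1 ^+ 2 - b2 ^+ 2 - b3 ^+ 2 in
  a2 ^+ 2 + a3 ^+ 2 = 1 ->
  (2 * b2 * d - a3 * I) ^+ 2 + (- 2 * b3 * d - a2 * I) ^+ 2 =
  (2 * b1 * d - I) ^+ 2.
Proof.
move=> d I a_null; apply/eqP; rewrite -subr_eq0; apply/eqP.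
transitivity ((a2 ^+ 2 + a3 ^+ 2 - 1) * I ^+ 2).
  by rewrite /d /I; ring.
by rewrite a_null subrr mul0r.
Qed.

(** * The two remaining components *)

(** In [x2 ^+ 2 + x3 ^+ 2] the [x0 x1] terms cancel, while [x1 ^+ 2] and
    [x0 ^+ 2] appear with coefficient [p ^+ 2 + q ^+ 2 = 1]; the former
    disappears against [- x1 ^+ 2] and the latter doubles [x0 ^+ 2]. *)
Lemma real_component_affine (K : comNzRingType)
    (a2 a3 b1 b2 b3 c0 p q D1 D2 x0 x1 : K) :
  let x2 := p * x1 + q * x0 + D1 in
  let x3 := - q * x1 + p * x0 + D2 in
  p ^+ 2 + q ^+ 2 = 1 ->
  x0 ^+ 2 - x1 ^+ 2 + x2 ^+ 2 + x3 ^+ 2 + 2 * x0 * (a2 * x2 + a3 * x3)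
    - b1 * x1 + b2 * x2 + b3 * x3 + c0 =
  (2 * p * D1 - 2 * q * D2 + b2 * p - b3 * q + 2 * (a2 * p - a3 * q) * x0
     - b1) * x1
  + (b2 * D1 + b3 * D2 + D1 ^+ 2 + D2 ^+ 2 + c0
     + 2 * (a2 * q + a3 * p + 1) * x0 ^+ 2
     + (2 * q * D1 + 2 * p * D2 + b2 * q + b3 * p + 2 * a2 * D1
        + 2 * a3 * D2) * x0).
Proof.
move=> x2 x3 pq1; apply/eqP; rewrite -subr_eq0; apply/eqP.
transitivity ((p ^+ 2 + q ^+ 2 - 1) * (x0 ^+ 2 + x1 ^+ 2)).
  by rewrite /x2 /x3; ring.
by rewrite pq1 subrr mul0r.
Qed.

Lemma i_component_affine (K : comNzRingType)
    (a2 a3 b1 b2 b3 c1 p q D1 D2 x0 x1 : K) :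
  let x2 := p * x1 + q * x0 + D1 in
  let x3 := - q * x1 + p * x0 + D2 in
  2 * x0 * (x1 + a3 * x2 - a2 * x3) + b1 * x0 + b3 * x2 - b2 * x3 + c1 =
  (2 * x0 * (a2 * q + a3 * p + 1) + (b2 * q + b3 * p)) * x1
  + ((2 * a3 * q - 2 * a2 * p) * x0 ^+ 2
     + (b3 * q - b2 * p + 2 * a3 * D1 - 2 * a2 * D2 + b1) * x0
     + b3 * D1 - b2 * D2 + c1).
Proof. by move=> x2 x3; rewrite /x2 /x3; ring. Qed.

(** The two summands are [4 x0 P ^+ 2] and [P I]. *)
Lemma slope_cancel (K : comNzRingType) (a2 a3 b1 b2 b3 x0 : K) :
  let P := - (a2 * b2) - a3 * b3 in
  let d := a2 * b3 - a3 * b2 + b1 in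
  let I := b1 ^+ 2 - b2 ^+ 2 - b3 ^+ 2 in
  let k1 := 2 * b2 * d - a3 * I in
  let k2 := - 2 * b3 * d - a2 * I in
  a2 ^+ 2 + a3 ^+ 2 = 1 -> 4 * x0 * P + I = 0 ->
  2 * x0 * (a2 * k2 + a3 * k1 + (2 * b1 * d - I)) + (b2 * k2 + b3 * k1) = 0.
Proof.
move=> P d I k1 k2 a_null class0.
transitivity (P * (4 * x0 * P + I)
  - (a2 ^+ 2 + a3 ^+ 2 - 1) * (2 * x0 * (2 * (b2 ^+ 2 + b3 ^+ 2) + I))).
  by rewrite /k1 /k2 /P /d /I; ring.
by rewrite a_null class0 subrr mulr0 mul0r subr0.
Qed.

(** * The quadratic equation *)

Theorem theorem5p1 (K : realType)
    (a2 a3 b1 b2 b3 c0 c1 c2 c3 : K) :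
  let a : splitquat K := 1 + a2 *: sqj + a3 *: sqk in
  let b : splitquat K := b1 *: sqi + b2 *: sqj + b3 *: sqk in
  let c : splitquat K := c0%:A + c1 *: sqi + c2 *: sqj + c3 *: sqk in
  let Pab := sqform a b in
  let Ib := sqform b b in
  let delta := a2 * b3 - a3 * b2 + b1 in
  let t1 := c2 - c0 * a2 - a3 * c1 in
  let t2 := c3 - c0 * a3 + a2 * c1 in
  let x0 := - Ib / (4 * Pab) in
  let k1 := 2 * b2 * delta - a3 * Ib in
  let k2 := - 2 * b3 * delta - a2 * Ib in
  let m := 2 * b1 * delta - Ib in
  let D1 := (- Pab * t1 - delta * t2) / m in
  let D2 := (delta * t1 - Pab * t2) / m in
  let R := (2 * k1 * D1 - 2 * k2 * D2 + b2 * k1 - b3 * k2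
            + 2 * (a2 * k1 - a3 * k2) * x0 - m * b1) / m in
  let L := b2 * D1 + b3 * D2 + D1 ^+ 2 + D2 ^+ 2 + c0
           + 2 * (a2 * k2 + a3 * k1 + m) / m * x0 ^+ 2
           + (2 * k2 * D1 + 2 * k1 * D2 + b2 * k2 + b3 * k1
              + 2 * a2 * D1 * m + 2 * a3 * D2 * m) / m * x0 in
  let F := (2 * a3 * k2 - 2 * a2 * k1) / m * x0 ^+ 2
           + ((b3 * k2 - b2 * k1) / m + 2 * a3 * D1 - 2 * a2 * D2 + b1) * x0
           + b3 * D1 - b2 * D2 + c1 in
  let is_solution (x : splitquat K) := a * x ^+ 2 + b * x + c = 0 in
  let in_class (x : splitquat K) := (2 * sqRe x) *: a + b \in sqnull in
  let condB := F = 0 /\ (R = 0 -> L = 0) in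
  a2 ^+ 2 + a3 ^+ 2 = 1 ->
  b <> 0 ->
  Pab <> 0 ->
  ((exists x : splitquat K, is_solution x /\ in_class x) <-> condB) /\
  (condB ->
    (R <> 0 ->
      let x2 := - (k1 * L / (m * R)) + k2 / m * x0 + D1 in
      let x3 := k2 * L / (m * R) + k1 / m * x0 + D2 in
      forall x : splitquat K,
        is_solution x /\ in_class x <->
        x = x0%:A - (L / R) *: sqi + x2 *: sqj + x3 *: sqk) /\
    (R = 0 ->
      forall x : splitquat K,
        is_solution x /\ in_class x <->
        exists x1 : K,
          x = x0%:A + x1 *: sqi
              + (k1 / m * x1 + k2 / m * x0 + D1) *: sqj
              + (- (k2 / m) * x1 + k1 / m * x0 + D2) *: sqk)).
Proof.
move=> a b c Pab Ib delta t1 t2 x0 k1 k2 m D1 D2 R L F sol cls condB a_null _.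
have aE : a = SplitQuat 1 0 a2 a3 by congr SplitQuat => /=; ring.
have bE : b = SplitQuat 0 b1 b2 b3 by congr SplitQuat => /=; ring.
have cE : c = SplitQuat c0 c1 c2 c3 by rewrite splitquatE.
have PE : Pab = - (a2 * b2) - a3 * b3.
  by rewrite /Pab aE bE /sqform /=; ring.
have IE : Ib = b1 ^+ 2 - b2 ^+ 2 - b3 ^+ 2.
  by rewrite /Ib bE /sqform /=; ring.
have a_form : sqform a a = 0.
  rewrite aE /sqform /=; transitivity (1 - (a2 ^+ 2 + a3 ^+ 2)); first by ring.
  by rewrite a_null subrr.
move=> /eqP P0.
have mE : m = Pab ^+ 2 + delta ^+ 2.
  by rewrite /m /delta PE IE; exact: det_sum_squares.
have m0 : m != 0.
  by rewrite mE gt_eqF // ltr_pwDl ?sqr_ge0 // exprn_even_gt0.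
have clsP x : cls x <-> sq0 x = x0.
  rewrite /cls inE sqform_lincomb a_form mulr0 add0r -/Pab -/Ib /sqRe /x0.
  split=> [/eqP e|->]; last by apply/eqP; field.
  have -> : Ib = - (4 * sq0 x * Pab).
    by apply/eqP; rewrite -subr_eq0 -e; apply/eqP; ring.
  by field.
have class0 : 4 * x0 * Pab + Ib = 0 by rewrite /x0; field.
have [k1E k2E] : k1 = - Pab * (b3 + a2 * b1) + delta * (b2 - a3 * b1) /\
                 k2 = - Pab * (b2 - a3 * b1) - delta * (b3 + a2 * b1).
  by rewrite /k1 /k2 /delta PE IE; exact: slope_numerators.
have pq1 : (k1 / m) ^+ 2 + (k2 / m) ^+ 2 = 1.
  have kk : k1 ^+ 2 + k2 ^+ 2 = m ^+ 2.
    by rewrite /k1 /k2 /m /delta IE; exact: slopes_sum_squares.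
  by rewrite !expr_div_n -mulrDl kk divff // expf_neq0.
(* The coefficient of [x1] in the component along [i]. *)
have slope0 : 2 * x0 * (a2 * (k2 / m) + a3 * (k1 / m) + 1)
              + (b2 * (k2 / m) + b3 * (k1 / m)) = 0.
  have num0 : 2 * x0 * (a2 * k2 + a3 * k1 + m) + (b2 * k2 + b3 * k1) = 0.
    rewrite /k1 /k2 /m /delta IE; apply: slope_cancel => //.
    by rewrite -PE -IE.
  by rewrite -[RHS](mul0r m^-1) -num0; field.
have systemP x1 x2 x3 :
    sol (SplitQuat x0 x1 x2 x3) <->
    [/\ x2 = k1 / m * x1 + k2 / m * x0 + D1,
        x3 = - (k2 / m) * x1 + k1 / m * x0 + D2, F = 0 & R * x1 + L = 0].
  have Rx1L := real_component_affine a2 a3 b1 b2 b3 c0 D1 D2 x0 x1 pq1.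
  have Fx1 := i_component_affine a2 a3 b1 b2 b3 c1 (k1 / m) (k2 / m) D1 D2 x0 x1.
  rewrite slope0 mul0r add0r in Fx1.
  have x23P : (Pab * x2 - delta * x3 =
                 - (t1 + (b3 + a2 * b1) * x1 + (b2 - a3 * b1) * x0) /\
               delta * x2 + Pab * x3 =
                 - (t2 - (b2 - a3 * b1) * x1 + (b3 + a2 * b1) * x0)) <->
              (x2 = k1 / m * x1 + k2 / m * x0 + D1 /\
               x3 = - (k2 / m) * x1 + k1 / m * x0 + D2).
    have nz : Pab ^+ 2 + delta ^+ 2 != 0 by rewrite -mE.
    rewrite rotation_systemP // -mE; set s := t1 + _ + _; set t := t2 - _ + _.
    have -> : (- Pab * s - delta * t) / m = k1 / m * x1 + k2 / m * x0 + D1.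
      by rewrite /s /t /D1 k1E k2E; field.
    suff -> : (delta * s - Pab * t) / m = - (k2 / m) * x1 + k1 / m * x0 + D2.
      by [].
    by rewrite /s /t /D2 k1E k2E; field.
  rewrite /sol aE bE cE quadratic_coordsP // -PE -/delta -/t1 -/t2.
  split=> [[E0 E1 E2 E3]|[x2E x3E F0 RL0]].
    have [x2E x3E] := x23P.1 (conj E2 E3).
    split=> //.
      by rewrite -E1 x2E x3E Fx1 /F; field.
    by rewrite -E0 x2E x3E Rx1L /R /L; field.
  have [E2 E3] := x23P.2 (conj x2E x3E).
  split=> //.
    by rewrite -RL0 x2E x3E Rx1L /R /L; field.
  by rewrite -F0 x2E x3E Fx1 /F; field.
(* From here on the system is [F = 0] together with an affine equation in
   [x1]; the formulas for its coefficients are irrelevant. *)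
clearbody R L F k1 k2 D1 D2 m x0.
have solP x : sol x /\ cls x <->
    [/\ F = 0, R * sq1 x + L = 0 &
        x = x0%:A + sq1 x *: sqi
            + (k1 / m * sq1 x + k2 / m * x0 + D1) *: sqj
            + (- (k2 / m) * sq1 x + k1 / m * x0 + D2) *: sqk].
  rewrite -splitquatE clsP; case: x => y0 x1 x2 x3 /=; split.
    by case=> + y0E; rewrite y0E => /systemP[-> -> F0 RL0].
  case=> F0 RL0 /splitquat_eqP[-> _ x2E x3E]; split=> //.
  by apply/systemP.
have line_sq1 x1 x2 x3 :
    sq1 (x0%:A + x1 *: sqi + x2 *: sqj + x3 *: sqk) = x1.
  by rewrite -splitquatE.
have lineP x1 : F = 0 -> R * x1 + L = 0 ->
    let x := x0%:A + x1 *: sqi + (k1 / m * x1 + k2 / m * x0 + D1) *: sqj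
             + (- (k2 / m) * x1 + k1 / m * x0 + D2) *: sqk in
    sol x /\ cls x.
  by move=> F0 RL0 x; apply/solP; rewrite line_sq1.
have root_R : R <> 0 -> R * - (L / R) + L = 0.
  by move=> /eqP R0; field.
split; last (move=> [F0 RL]; split=> R0).
- split=> [[x /solP[F0 RL0 _]]|[F0 RL]].
    by split=> // R0; rewrite R0 mul0r add0r in RL0.
  case: (eqVneq R 0) => [R0|/eqP R0].
    by eexists; apply: (lineP 0) => //; rewrite mulr0 add0r RL.
  by eexists; apply: (lineP (- (L / R))) => //; exact: root_R.
- move=> x2 x3 x.
  have R0' : R != 0 by apply/eqP.
  have x2E : k1 / m * - (L / R) + k2 / m * x0 + D1 = x2.
    by rewrite /x2; field; rewrite m0.
  have x3E : - (k2 / m) * - (L / R) + k1 / m * x0 + D2 = x3.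
    by rewrite /x3; field; rewrite m0.
  rewrite -{}x2E -{}x3E.
  rewrite -scaleNr; split=> [/solP[_ RL0 xE]|->]; last first.
    by apply: lineP => //; exact: root_R.
  suff <- : sq1 x = - (L / R) by [].
  have -> : L = - (R * sq1 x) by apply/eqP; rewrite -addr_eq0 addrC RL0.
  by field.
- move=> x; split=> [/solP[_ _ xE]|[x1 ->]]; first by exists (sq1 x).
  by apply: lineP => //; rewrite R0 mul0r add0r RL.
Qed.
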